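(* Let $G$ be a finite simple $2$-connected graph and let $v \in V(G)$ with $d(v) \geq 3$. Then $v$ is contained in a cycle of even length.
   Context: Graphs are finite, simple (no loops, no multiple edges). $d(v)$ denotes the degree of $v$. A graph is $2$-connected if it has more than $2$ vertices and remains connected whenever fewer than $2$ vertices are removed. The length of a cycle is its number of edges. *)

(* Defs.v *)
From mathcomp Require Import all_boot.
Set Implicit Arguments.
Unset Strict Implicit.
Unset Printing Implicit Defensive.

(* A finite simple graph is a finType V of vertices together with a symmetric
   irreflexive adjacency relation e : rel V. *)

Definition degree (V : finType) (e : rel V) (v : V) : nat :=
  #|[set u | e v u]|.

(* The vertices outside A stay in the carrier type as isolated points, so
   connectedness below only quantifies over the vertices in A. *)
Definition induced (V : finType) (e : rel V) (A : {set V}) : rel V :=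
  [rel x y | [&& x \in A, y \in A & e x y]].

Definition connected_on (V : finType) (e : rel V) (A : {set V}) : Prop :=
  A != set0 /\ {in A &, forall x y, connect (induced e A) x y}.

Definition k_connected (k : nat) (V : finType) (e : rel V) : Prop :=
  k < #|V| /\
  forall X : {set V}, #|X| < k -> connected_on e (~: X).

(* The cyclic sequence of distinct vertices of a cycle; its length (number of
   edges) is size c.  The bound 2 < size c matters: for an edge xy,
   ucycle e [:: x; y] also holds, as does ucycle e [::]. *)
Definition graph_cycle (V : finType) (e : rel V) (c : seq V) : Prop :=
  2 < size c /\ ucycle e c.

(* Main.v *)
(** Choose three neighbours [a], [b], [c] of [v].  As [G - v] is connected, it
    contains a path from [a] to [b], and a path from [c] to that one, cut at the
    first vertex [x] where they meet.  This gives three paths in [G - v] from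
    [x] to [a], [b] and [c], pairwise disjoint outside [x].  Two of them have
    lengths of the same parity, and together with [v] they form an even cycle. *)

Require Import Defs.
From mathcomp Require Import all_boot.

(** Cuts a path that ends in [S] at its first vertex in [S]; [p1] is empty exactly when [x] already
    lies in [S]. *)
Lemma path_first_hit (T : Type) (S : pred T) (x : T) (p : seq T) :
  S (last x p) ->
  exists p1 p2, [/\ p = p1 ++ p2, S (last x p1) & all (predC S) (belast x p1)].
Proof.
elim: p x => [|y p IHp] x /= Slast; first by exists [::], [::].
have [Sx|nSx] := boolP (S x); first by exists [::], (y :: p).
have [p1 [p2 [-> Sp1 nSp1]]] := IHp y Slast.
by exists (y :: p1), p2; split=> //=; rewrite nSx.
Qed.

Lemma path_induced (V : finType) (e : rel V) (A : {set V}) (x : V) (p : seq V) :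
  path (induced e A) x p -> path e x p /\ {subset p <= A}.
Proof.
elim: p x => [|y p IHp] x //= /andP[/and3P[_ Ay exy] /IHp[-> sub_p]].
rewrite exy; split=> // z; rewrite inE => /predU1P[->|/sub_p] //.
Qed.

Lemma path_rev_belast (T : Type) (e : rel T) (e_sym : symmetric e)
    (x : T) (p : seq T) :
  path e (last x p) (rev (belast x p)) = path e x p.
Proof. by rewrite rev_path; apply: eq_path => y z; rewrite e_sym. Qed.

Lemma last_rev_belast (T : Type) (x : T) (p : seq T) :
  last (last x p) (rev (belast x p)) = x.
Proof. by case: p => //= y p; rewrite rev_cons last_rcons. Qed.

(** Closing the two paths through [v] gives a cycle of length [size p + size q + 2], even when the
    parities agree. Either path may be empty, but distinct ends prevent both from being so. *)
Lemma even_cycle_of_paths (V : finType) (e : rel V) (e_sym : symmetric e)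
    (v x : V) (p q : seq V) :
  path e x p -> path e x q -> e v (last x p) -> e v (last x q) ->
  last x p != last x q -> uniq (v :: x :: p ++ q) ->
  odd (size p) = odd (size q) ->
  exists c : seq V, [/\ graph_cycle e c, v \in c & ~~ odd (size c)].
Proof.
move=> e_p e_q ev_p ev_q neq_pq uniq_vxpq odd_pq.
pose c := x :: p ++ v :: rev q.
have perm_c : perm_eq c (v :: x :: p ++ q).
  rewrite -[v :: x :: _]/([:: v] ++ (x :: p) ++ q) perm_sym perm_catCA.
  by rewrite -[c]/((x :: p) ++ [:: v] ++ rev q) !perm_cat2l perm_sym perm_rev.
have size_c : size c = (size p + size q).+2.
  by rewrite (perm_size perm_c) /= size_cat.
exists c; split; first split.
- rewrite size_c !ltnS lt0n addn_eq0; apply: contra neq_pq.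
  by case/andP=> /nilP-> /nilP->.
- apply/andP; split; last by rewrite (perm_uniq perm_c).
  (* The way back from [v] to [x] is the reversal of [x :: q], which starts at [last x q], a
     neighbour of [v]. *)
  rewrite /= rcons_cat cat_path e_p /= e_sym ev_p /= -rev_cons lastI rev_rcons.
  by rewrite /= ev_q path_rev_belast.
- by rewrite (perm_mem perm_c) mem_head.
- by rewrite size_c /= negbK oddD odd_pq addbb.
Qed.

Theorem theorem4 (V : finType) (e : rel V)
    (e_sym : symmetric e) (e_irr : irreflexive e)
    (e_2conn : k_connected 2 e)
    (v : V) (v_deg : 3 <= degree e v) :
  exists c : seq V, [/\ graph_cycle e c, v \in c & ~~ odd (size c)].
Proof.
have [a [b [c [[]]]]] := card_gt2P v_deg.
rewrite !inE => eva evb evc [neq_ab neq_bc neq_ca].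
have nbr_v u : e v u -> u \in ~: [set v].
  by move=> evu; rewrite !inE; apply: contraTneq evu => ->; rewrite e_irr.
have [_ conn_v] : connected_on e (~: [set v]).
  by apply: e_2conn.2; rewrite cards1.
have uniq_path u w : e v u -> e v w -> exists p : seq V,
    [/\ path e u p, last u p = w, uniq (u :: p) & v \notin u :: p].
  move=> evu evw.
  have /connectP[p0 + ->] := conn_v u w (nbr_v u evu) (nbr_v w evw).
  case/shortenP=> p /path_induced[e_p sub_p] uniq_p _.
  exists p; split=> //; rewrite inE negb_or eq_sym.
  have:= nbr_v u evu; rewrite !inE => ->.
  by apply/negP => /sub_p; rewrite !inE eqxx.
have [p [e_p last_p uniq_p nv_p]] := uniq_path a b eva evb.
(* The target [a] lies on the path [a :: p], so [q] is sure to meet it. *)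
have [q [e_q last_q uniq_q nv_q]] := uniq_path c a evc eva.
have: last c q \in a :: p by rewrite last_q mem_head.
case/(@path_first_hit _ (mem (a :: p))) => q1 [q2 [def_q /= x_p disj_q1]].
set x := last c q1 in x_p.
case/splitPl: x_p e_p last_p uniq_p nv_p disj_q1 => p1 p2 last_p1.
rewrite cat_path last_cat last_p1.
case/andP=> e_p1 e_p2 last_p2 uniq_p nv_p disj_q1.
(* Seen from [x], the three paths are [r1] to [a], [p2] to [b] and [r3] to [c]; the one whose end
   equals [x] is empty. *)
pose r1 := rev (belast a p1); pose r3 := rev (belast c q1).
have e_q1 : path e c q1 by move: e_q; rewrite def_q cat_path => /andP[].
have e_r1 : path e x r1 by rewrite -last_p1 path_rev_belast.
have e_r3 : path e x r3 by rewrite path_rev_belast.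
have last_r1 : last x r1 = a by rewrite -last_p1 last_rev_belast.
have last_r3 : last x r3 = c by rewrite last_rev_belast.
have perm_p : perm_eq (a :: p1 ++ p2) (x :: r1 ++ p2).
  rewrite -!cat_cons perm_cat2r lastI last_p1.
  by rewrite perm_rcons perm_cons perm_sym perm_rev.
have uniq_vp : uniq (v :: x :: r1 ++ p2).
  by rewrite cons_uniq -(perm_mem perm_p) nv_p -(perm_uniq perm_p).
have uniq_r3 : uniq r3 && (v \notin r3).
  rewrite rev_uniq mem_rev; move: uniq_q nv_q.
  rewrite def_q -cat_cons lastI cat_uniq rcons_uniq mem_cat mem_rcons inE.
  by rewrite !negb_or => /andP[/andP[_ ->] _] /andP[/andP[_ ->]].
(* The vertices of [r3] come before the first hit, hence lie off [a :: p]. *)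
have disj_r3 : ~~ has (mem (v :: x :: r1 ++ p2)) r3.
  apply/hasPn => y y_r3; rewrite [mem _ y]inE negb_or.
  apply/andP; split; first by apply: contraTneq y_r3 => ->; case/andP: uniq_r3.
  rewrite -(perm_mem perm_p).
  by move: y_r3; rewrite mem_rev => /(allP disj_q1).
have uniq_all : uniq ((v :: x :: r1 ++ p2) ++ r3).
  by rewrite cat_uniq uniq_vp disj_r3; case/andP: uniq_r3.
have uniq_sub s : subseq s ((v :: x :: r1 ++ p2) ++ r3) -> uniq s.
  by move=> sub_s; apply: subseq_uniq sub_s uniq_all.
have [odd12|odd12] := eqVneq (odd (size r1)) (odd (size p2)).
  apply: (even_cycle_of_paths V e e_sym v x r1 p2 _ _ _ _ _ uniq_vp) => //.
  - by rewrite last_r1.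
  - by rewrite last_p2.
  - by rewrite last_r1 last_p2.
have [odd13|odd13] := eqVneq (odd (size r1)) (odd (size r3)).
  apply: (even_cycle_of_paths V e e_sym v x r1 r3 e_r1 e_r3) => //.
  - by rewrite last_r1.
  - by rewrite last_r3.
  - by rewrite last_r1 last_r3 eq_sym.
  - apply: uniq_sub; rewrite -[v :: x :: r1 ++ r3]/((v :: x :: r1) ++ r3).
    by apply: cat_subseq => //; apply: (prefix_subseq (v :: x :: r1)).
(* The lengths of [p2] and [r3] both differ in parity from that of [r1], so they agree with each
   other. *)
apply: (even_cycle_of_paths V e e_sym v x p2 r3 e_p2 e_r3).
- by rewrite last_p2.
- by rewrite last_r3.
- by rewrite last_p2 last_r3.
- apply: uniq_sub; rewrite -[v :: x :: p2 ++ r3]/((v :: x :: p2) ++ r3).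
  by apply: cat_subseq => //=; rewrite !eqxx; apply: suffix_subseq.
- by move: odd12 odd13; do 3!case: odd.
Qed.
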